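(* Let $f\in\mathbb{Z}[x]$ and let $n$ be a positive integer, and suppose that $f^n(x)-x$ has no repeated roots (in $\overline{\mathbb{Q}}$). Then for all but finitely many primes $p$, $$[\Phi_{f,n}]_p\text{ has a root in }\mathbb{F}_p\quad\text{if and only if}\quad(\mathbb{F}_p,[f]_p)\text{ has a point of period }n.$$
   Context: $f^n$ denotes the $n$-fold composition of $f$ with itself. The $n$th dynatomic polynomial of $f$ is $$\Phi_{f,n}(x)=\prod_{d\mid n}\left(f^d(x)-x\right)^{\mu(n/d)},$$ where $\mu$ is the Möbius function; it is a known fact that this is a polynomial (with integer coefficients if $f$ is monic; in any case it has rational coefficients, so that its reduction mod $p$ makes sense for all but finitely many $p$). For a polynomial $g$, $[g]_p\in\mathbb{F}_p[x]$ denotes the polynomial obtained by reducing the coefficients of $g$ mod $p$. A point $s\in\mathbb{F}_p$ has period $n$ in $(\mathbb{F}_p,[f]_p)$ if $n$ is the smallest positive integer with $([f]_p)^n(s)=s$. *)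

(* Defs.v *)
From HB Require Import structures.
From mathcomp Require Import all_boot all_order all_algebra all_field.

Set Implicit Arguments.
Unset Strict Implicit.
Unset Printing Implicit Defensive.

Import GRing.Theory.
Local Open Scope ring_scope.

(* f^n = f \o ... \o f (n times), with f^0 = 'X. *)
Definition iter_poly (R : comNzRingType) (f : {poly R}) (n : nat) : {poly R} :=
  iter n (fun g => f \Po g) 'X.

Definition moebius (n : nat) : int :=
  if all (fun p => logn p n == 1%N) (primes n)
  then (-1) ^+ size (primes n) else 0.

(* A fraction that is a polynomial, viewed as that polynomial (see poly_of_fracK);
   on the other fractions the value is irrelevant. *)
Definition poly_of_frac (F : fieldType) (u : {fraction {poly F}}) : {poly F} :=
  \n_(repr u) %/ \d_(repr u).

Lemma poly_of_fracK (F : fieldType) :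
  cancel (@FracField.tofrac {poly F}) (@poly_of_frac F).
Proof.
move=> g; rewrite /poly_of_frac.
set u := FracField.tofrac g.
have d0 : \d_(repr u) != 0 by exact: denom_ratioP.
have uE : u = \pi_({fraction {poly F}})%qT (Ratio g 1) by rewrite /u !piE.
have := FracField.equivf_l (Ratio g 1).
rewrite -uE !numden_Ratio ?oner_eq0 // mulr1.
by move=> ->; rewrite mulrC mulpK.
Qed.

Definition dynatomic_frac (f : {poly int}) (n : nat) : {fraction {poly rat}} :=
  \prod_(d <- divisors n)
    FracField.tofrac (iter_poly (map_poly intr f) d - 'X) ^ moebius (n %/ d)%N.

Definition dynatomic (f : {poly int}) (n : nat) : {poly rat} :=
  poly_of_frac (dynatomic_frac f n).

(* Coefficientwise reduction mod p. It is the usual one when p divides no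
   denominator of a coefficient of g, that is for all but finitely many p;
   for the other p, ratr involves 0^-1 = 0 in 'F_p. *)
Definition reduce_rat (p : nat) (g : {poly rat}) : {poly 'F_p} :=
  map_poly (fun c : rat => ratr c) g.

Definition reduce_int (p : nat) (f : {poly int}) : {poly 'F_p} :=
  map_poly (fun c : int => c%:~R) f.

Definition has_period (T : Type) (g : T -> T) (n : nat) (s : T) : Prop :=
  [/\ (0 < n)%N, iter n g s = s
    & forall m : nat, (0 < m < n)%N -> iter m g s <> s].

(* 0 has repeated roots in this sense. *)
Definition no_repeated_roots (h : {poly int}) : Prop :=
  forall z : algC, ~ (('X - z%:P) ^+ 2 %| map_poly intr h).

(* Main.v *)
Require Import Defs.
From mathcomp Require Import all_boot all_order all_algebra all_field.
From mathcomp Require Import ring zify.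

(** Write h_d for f^d - 'X, so that Phi_n is the product of the h_d with
    mu (n/d) = 1, the numerator A, divided by the product of the h_d with
    mu (n/d) = -1, the denominator B.

    Over the algebraic numbers h_n has distinct roots, and so does each h_d with
    d dividing n, since h_d divides h_n.  A root z of h_n has an exact period k
    dividing n, and z is a root of h_d exactly when k divides d.  The multiplicity
    of z in A minus that in B is therefore the sum of mu (n/d) over the d with
    k | d | n, which is 1 if k = n and 0 otherwise
    ([count_moebius_multiples]).  Hence B divides A, and A h_k divides B h_n for
    each proper divisor k of n ([dynatomic_dvd]).  In other words Phi_n is a
    polynomial, and Phi_n h_k divides h_n: the roots of Phi_n are the roots of
    h_n that are not roots of such an h_k.

    All this is expressed by finitely many identities between integer polynomials
    once multiplied by nonzero integers: a A = G B, where Phi_n = G / a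
    ([dynatomic_int]); G h_k divides c_k h_n; and U h_n + V h_n' = N, which
    records that h_n is separable ([no_repeated_roots_Bezout]).  If the prime p
    divides none of a, N and the c_k, these identities survive reduction modulo
    p, and they suffice to compare roots of G with points of period n
    ([root_dynatomic_period]).  If s is a root of G, then A vanishes at s, so s is
    periodic with a period k dividing n; were k < n, s would be a root of both G
    and h_k, hence a double root of the separable polynomial h_n.  Conversely, if
    s has period n, then h_n vanishes at s but B does not, so a A = G B forces
    G to vanish at s. *)

Set Implicit Arguments.
Unset Strict Implicit.
Unset Printing Implicit Defensive.
Import GRing.Theory Num.Theory.

Local Open Scope ring_scope.

(** * Sums of the Moebius function over divisors *)

Lemma moebius_cases (n : nat) :
  moebius n = (moebius n == 1)%:R - (moebius n == -1)%:R.
Proof.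
rewrite /moebius; case: ifP => // _.
by rewrite -signr_odd; case: (odd _).
Qed.

Lemma moebius_square (q n : nat) :
  prime q -> (0 < n)%N -> (q ^ 2 %| n)%N -> moebius n = 0.
Proof.
move=> q_pr n_gt0; rewrite pfactor_dvdn // => le2.
rewrite /moebius; case: ifP => // /allP /(_ q).
by rewrite -logn_gt0 (ltn_trans _ le2) // => /(_ isT) /eqP e1; rewrite e1 in le2.
Qed.

Lemma moebiusM_prime (q e : nat) :
  prime q -> (0 < e)%N -> ~~ (q %| e)%N -> moebius (q * e) = - moebius e.
Proof.
move=> q_pr e_gt0 ndvd; have q_gt0 := prime_gt0 q_pr.
have logq : logn q e = 0%N by apply/eqP; rewrite -leqn0 leqNgt -pfactor_dvdn.
have Pq : perm_eq (primes (q * e)) (q :: primes e).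
  apply: uniq_perm; rewrite ?primes_uniq //=.
    by rewrite primes_uniq andbT mem_primes q_pr e_gt0.
  by move=> p; rewrite primesM // primes_prime // !inE.
rewrite /moebius (perm_size Pq) (perm_all _ Pq) /= exprS mulN1r.
rewrite lognM // logn_prime // eqxx logq /=.
have -> : all (fun p => logn p (q * e) == 1%N) (primes e)
        = all (fun p => logn p e == 1%N) (primes e).
  apply: eq_in_all => p p_e; rewrite lognM // logn_prime //.
  by case: (eqVneq p q) p_e => [-> | _ _] //; rewrite mem_primes q_pr e_gt0 (negPf ndvd).
by case: ifP; rewrite ?oppr0.
Qed.

(** For a prime q dividing m, the divisors of m divisible by q^2 contribute 0,
    and multiplication by q matches the divisors prime to q with those divisible
    by q exactly once, changing the sign of the Moebius function. *)
Lemma sum_moebius (m : nat) :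
  (0 < m)%N -> \sum_(e <- divisors m) moebius e = (m == 1%N)%:R.
Proof.
move=> m_gt0; have [-> | m_neq1] := eqVneq m 1%N; first by rewrite big_seq1.
have q_pr : prime (pdiv m) by apply: pdiv_prime; lia.
set q := pdiv m in q_pr; have q_m : (q %| m)%N := pdiv_dvd m.
have q_gt0 := prime_gt0 q_pr.
have gt0 e : e \in divisors m -> (0 < e)%N.
  by rewrite -dvdn_divisors // => /dvdn_gt0; apply.
rewrite (bigID (fun e => q %| e)%N) /=.
rewrite (bigID (fun e => q ^ 2 %| e)%N) /=.
rewrite [X in X + _ + _]big_seq_cond big1 ?add0r => [|e]; last first.
  by case/andP=> /gt0 e_gt0 /andP[_]; apply: moebius_square.
rewrite -big_filter -[X in _ + X]big_filter.
set S1 := filter _ _; set S2 := filter _ _.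
have P12 : perm_eq S1 [seq (q * e)%N | e <- S2].
  apply: uniq_perm; rewrite ?filter_uniq ?divisors_uniq //.
    rewrite map_inj_uniq ?filter_uniq ?divisors_uniq //.
    by move=> x y /eqP; rewrite eqn_pmul2l // => /eqP.
  move=> e; rewrite mem_filter -dvdn_divisors //.
  apply/idP/mapP => [/andP[/andP[/dvdnP[c ->]]] | [c]].
    rewrite expnS expn1 dvdn_pmul2r // => nqc cq_m; exists c; last by rewrite mulnC.
    rewrite mem_filter nqc -dvdn_divisors //=.
    exact: dvdn_trans (dvdn_mulr q (dvdnn c)) cq_m.
  rewrite mem_filter -dvdn_divisors // => /andP[nqc c_m] ->.
  rewrite dvdn_mulr // expnS expn1 dvdn_pmul2l // nqc /=.
  by rewrite Gauss_dvd ?q_m // prime_coprime.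
rewrite (perm_big _ P12) big_map -big_split /=.
rewrite big_seq big1 // => e; rewrite mem_filter => /andP[nqe /gt0 e_gt0].
by rewrite moebiusM_prime // addNr.
Qed.

(** The involution d |-> n/d turns the multiples of k among the divisors of n into
    the divisors of n/k. *)
Lemma sum_moebius_multiples (n k : nat) :
    (0 < n)%N -> (k %| n)%N ->
  \sum_(d <- divisors n | (k %| d)%N) moebius (n %/ d) = (n == k)%:R.
Proof.
move=> n_gt0 k_n; have k_gt0 := dvdn_gt0 n_gt0 k_n.
have m_gt0 : (0 < n %/ k)%N by rewrite divn_gt0 // dvdn_leq.
have <- : ((n %/ k == 1) = (n == k))%N by rewrite eq_sym eqn_div // mul1n eq_sym.
rewrite -sum_moebius // -big_filter.
have P : perm_eq (divisors (n %/ k))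
          [seq (n %/ d)%N | d <- [seq d <- divisors n | (k %| d)%N]].
  have divnK' d : (d %| n)%N -> (n %/ (n %/ d) = d)%N.
    by move=> d_n; rewrite divnA // mulKn.
  apply: uniq_perm; rewrite ?divisors_uniq //.
    rewrite map_inj_in_uniq ?filter_uniq ?divisors_uniq // => x y.
    rewrite !mem_filter -!dvdn_divisors // => /andP[_ x_n] /andP[_ y_n] eq_xy.
    by rewrite -(divnK' x) // eq_xy divnK'.
  move=> e; rewrite -dvdn_divisors //; apply/idP/mapP.
  - move=> e_m; have e_n := dvdn_trans e_m (dvdn_div k_n).
    exists (n %/ e)%N; last by rewrite divnK'.
    rewrite mem_filter -dvdn_divisors // dvdn_div // andbT.
    by rewrite dvdn_divRL // mulnC -dvdn_divRL.
  - case=> d; rewrite mem_filter -dvdn_divisors // => /andP[k_d d_n] ->.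
    rewrite dvdn_divRL // -[X in (_ %| X)%N](divnK d_n) dvdn_pmul2l //.
    by rewrite divn_gt0 ?(dvdn_gt0 n_gt0 d_n) // (dvdn_leq n_gt0 d_n).
by rewrite (perm_big _ P) big_map.
Qed.

(** The previous sum with its positive and negative terms on separate sides: in
    this form it compares exponents, which are natural numbers, in the numerator
    and the denominator of the dynatomic fraction. *)
Lemma count_moebius_multiples (n k : nat) :
    (0 < n)%N -> (k %| n)%N ->
  (\sum_(d <- divisors n | moebius (n %/ d) == 1%Z) (k %| d) =
   \sum_(d <- divisors n | moebius (n %/ d) == (-1)%Z) (k %| d) + (n == k))%N.
Proof.
move=> n_gt0 k_n; apply/eqP; rewrite -(eqr_nat int) natrD !natr_sum.
rewrite -(sum_moebius_multiples n_gt0 k_n).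
rewrite [X in _ == _ + X]big_mkcond [X in _ == X + _]big_mkcond [X in X == _]big_mkcond.
rewrite -big_split /=; apply/eqP/eq_bigr => d _.
rewrite {3}moebius_cases; case: (k %| d)%N; rewrite /= ?addr0; last first.
  by do !case: ifP.
by case: eqP; case: eqP => //= _ _; rewrite ?addr0 ?subrr ?addrC ?subrr ?subr0 ?subrK ?addKr.
Qed.

(** * Periods and the polynomials f^d - X *)

Lemma exact_period (T : eqType) (g : T -> T) (n : nat) (s : T) :
    (0 < n)%N -> iter n g s = s ->
  exists k, forall d, (iter d g s == s) = (k %| d)%N.
Proof.
move=> n_gt0 gns; pose P m := (0 < m)%N && (iter m g s == s).
have exP : exists m, P m by exists n; rewrite /P n_gt0 gns eqxx.
case: (ex_minnP exP) => k /andP[k_gt0 /eqP gks] kmin; exists k => // d.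
have gqk q : iter (q * k) g s = s.
  by elim: q => //= q IHq; rewrite mulSn iterD IHq.
rewrite {1}(divn_eq d k) addnC iterD gqk /dvdn.
case: (posnP (d %% k)) => [-> | mod_gt0]; first by rewrite !eqxx.
apply/negP => per.
have := kmin (d %% k)%N; rewrite /P mod_gt0 per => /(_ isT).
by rewrite leqNgt ltn_pmod.
Qed.

Definition periodic_poly (R : comNzRingType) (f : {poly R}) (d : nat) : {poly R} :=
  iter_poly f d - 'X.

(** The dynatomic fraction has [dynatomic_num] as numerator and [dynatomic_den] as
    denominator, because the Moebius function only takes the values 0, 1, -1.
    They make sense over any ring, which lets them be compared across reductions
    and embeddings. *)
Definition dynatomic_num (R : comNzRingType) (f : {poly R}) (n : nat) :=
  \prod_(d <- divisors n | moebius (n %/ d) == 1%Z) periodic_poly f d.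

Definition dynatomic_den (R : comNzRingType) (f : {poly R}) (n : nat) :=
  \prod_(d <- divisors n | moebius (n %/ d) == (-1)%Z) periodic_poly f d.

Section Morphism.
Variables (R S : comNzRingType) (phi : {rmorphism R -> S}) (f : {poly R}).

Lemma map_periodic_poly (d : nat) :
  map_poly phi (periodic_poly f d) = periodic_poly (map_poly phi f) d.
Proof.
rewrite /periodic_poly rmorphB /= map_polyX; congr (_ - _).
elim: d => [|d IHd]; first by rewrite /= map_polyX.
by rewrite /iter_poly !iterS map_comp_poly -/(iter_poly _ _) IHd.
Qed.

Lemma map_dynatomic_num (n : nat) :
  map_poly phi (dynatomic_num f n) = dynatomic_num (map_poly phi f) n.
Proof. by rewrite rmorph_prod; apply: eq_bigr => d _; rewrite /= map_periodic_poly. Qed.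

Lemma map_dynatomic_den (n : nat) :
  map_poly phi (dynatomic_den f n) = dynatomic_den (map_poly phi f) n.
Proof. by rewrite rmorph_prod; apply: eq_bigr => d _; rewrite /= map_periodic_poly. Qed.

End Morphism.

Lemma horner_periodic_poly (R : comNzRingType) (f : {poly R}) (d : nat) (x : R) :
  (periodic_poly f d).[x] = iter d (horner f) x - x.
Proof.
rewrite hornerD hornerN hornerX; congr (_ - _).
by elim: d => [|d IHd]; rewrite /iter_poly ?hornerX // !iterS horner_comp -IHd.
Qed.

Lemma root_periodic_poly (R : comNzRingType) (f : {poly R}) (d : nat) (x : R) :
  root (periodic_poly f d) x = (iter d (horner f) x == x).
Proof. by rewrite /root horner_periodic_poly subr_eq0. Qed.

Lemma dvdp_sub_comp (R : idomainType) (g p q : {poly R}) :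
  (p - q %| (g \Po p) - (g \Po q)).
Proof.
elim/poly_ind: g => [|g c IHg]; first by rewrite !comp_poly0 subrr dvdp0.
have -> : (g * 'X + c%:P) \Po p - ((g * 'X + c%:P) \Po q)
        = (g \Po p) * (p - q) + ((g \Po p) - (g \Po q)) * q.
  by rewrite !comp_poly_MXaddC; ring.
by apply: dvdp_add; [exact: dvdp_mull | exact: dvdp_mulr].
Qed.

(** By induction on m, where e = m d, since f^(md + d) - X is the sum of f^(md) \Po f^d -
    f^(md) \Po X, a multiple of f^d - X, and of f^(md) - X. *)
Lemma dvdp_periodic_poly (R : idomainType) (f : {poly R}) (d e : nat) :
  (d %| e)%N -> periodic_poly f d %| periodic_poly f e.
Proof.
case/dvdnP=> m ->; elim: m => [|m IHm].
  by rewrite mul0n /periodic_poly subrr dvdp0.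
have iterD_poly a b : iter_poly f (a + b) = iter_poly f a \Po iter_poly f b.
  elim: a => [|a IHa]; first by rewrite comp_polyX.
  by rewrite addSn /iter_poly !iterS -!/(iter_poly _ _) IHa comp_polyA.
have -> : periodic_poly f (m.+1 * d)
  = ((iter_poly f (m * d) \Po iter_poly f d) - (iter_poly f (m * d) \Po 'X))
    + periodic_poly f (m * d).
  by rewrite mulSn addnC /periodic_poly iterD_poly comp_polyXr; ring.
by rewrite dvdp_add // dvdp_sub_comp.
Qed.

(** * Divisibility of the dynatomic products when f^n - X splits *)

Lemma eqp_prod_roots (R : idomainType) (r : seq R) (p : {poly R}) :
    uniq r -> p %| \prod_(z <- r) ('X - z%:P) ->
  p %= \prod_(z <- r) ('X - z%:P) ^+ root p z.
Proof.
move=> r_uniq /dvdp_prod_XsubC[m pE]; apply: (eqp_trans pE).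
rewrite (mask_filter m r_uniq) big_filter big_mkcond /=.
set s := mask m r in pE *; rewrite (eq_bigr (fun z => ('X - z%:P) ^+ root p z)) ?eqpxx //.
by move=> z _; rewrite (eqp_root pE) root_prod_XsubC; case: (z \in s).
Qed.

Lemma eqp_prod_exp_roots (R : idomainType) (I : Type) (s : seq I) (P : pred I)
    (r : seq R) (F : I -> {poly R}) (e : I -> R -> nat) :
    (forall i, P i -> F i %= \prod_(z <- r) ('X - z%:P) ^+ e i z) ->
  \prod_(i <- s | P i) F i
    %= \prod_(z <- r) ('X - z%:P) ^+ (\sum_(i <- s | P i) e i z).
Proof.
move=> FE; under [X in _ %= X]eq_bigr => z _ do rewrite expr_sum.
rewrite exchange_big /=.
elim/big_rec2: _ => [|i p q Pi qp]; first exact: eqpxx.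
exact: eqp_trans (eqp_mulr _ (FE i Pi)) (eqp_mull _ qp).
Qed.

Lemma dvdp_prod_exp (R : idomainType) (r : seq R) (a b : R -> nat) :
    {in r, forall z, a z <= b z}%N ->
  \prod_(z <- r) ('X - z%:P) ^+ a z %| \prod_(z <- r) ('X - z%:P) ^+ b z.
Proof.
move=> le_ab; rewrite big_seq [X in _ %| X]big_seq.
elim/big_rec2: _ => [|z p q z_r pq]; first exact: dvdpp.
by rewrite dvdp_mul // dvdp_exp2l ?le_ab.
Qed.

(** All the polynomials involved are products of powers of the X - z for z in r,
    up to constants, so it is enough to compare exponents.  The second part says
    that the dynatomic polynomial times f^k - X divides f^n - X, in a form free of
    fractions. *)
Lemma dynatomic_dvd (R : idomainType) (f : {poly R}) (n : nat) (r : seq R) :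
    (0 < n)%N -> uniq r -> periodic_poly f n %= \prod_(z <- r) ('X - z%:P) ->
  dynatomic_den f n %| dynatomic_num f n
  /\ forall k, (k %| n)%N -> (k < n)%N ->
     dynatomic_num f n * periodic_poly f k
       %| dynatomic_den f n * periodic_poly f n.
Proof.
move=> n_gt0 r_uniq hnE.
have hdE d : (d %| n)%N -> periodic_poly f d
    %= \prod_(z <- r) ('X - z%:P) ^+ (iter d (horner f) z == z).
  move=> /(dvdp_periodic_poly f); rewrite (eqp_dvdr _ hnE) => /(eqp_prod_roots r_uniq).
  by under eq_bigr => z _ do rewrite root_periodic_poly.
have prodE (c : int) : \prod_(d <- divisors n | moebius (n %/ d) == c) periodic_poly f d
  %= \prod_(z <- r) ('X - z%:P) ^+
       (\sum_(d <- divisors n | moebius (n %/ d) == c) (iter d (horner f) z == z)).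
  rewrite big_seq_cond; under [X in _ %= X]eq_bigr => z _ do rewrite big_seq_cond.
  by apply: eqp_prod_exp_roots => d /andP[]; rewrite -dvdn_divisors // => /hdE.
have countE z : z \in r -> exists2 k, (k %| n)%N &
  (forall d, (iter d (horner f) z == z) = (k %| d)%N) /\
  (\sum_(d <- divisors n | moebius (n %/ d) == 1%Z) (iter d (horner f) z == z)
  = \sum_(d <- divisors n | moebius (n %/ d) == (-1)%Z) (iter d (horner f) z == z)
    + (n == k))%N.
  rewrite -root_prod_XsubC -(eqp_root hnE) root_periodic_poly => /eqP per.
  have [k kE] := exact_period n_gt0 per.
  have k_n : (k %| n)%N by rewrite -kE; apply/eqP.
  exists k => //; split=> //; have := count_moebius_multiples n_gt0 k_n.
  by under eq_bigr => d _ do rewrite -kE; under [X in (X + _)%N]eq_bigr => d _ do rewrite -kE.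
split; first rewrite (eqp_dvdl _ (prodE _)) (eqp_dvdr _ (prodE _)).
  by apply: dvdp_prod_exp => z /countE[k _ [_ ->]]; rewrite leq_addr.
move=> k k_n k_lt.
have eqM (p p' q q' : {poly R}) : p %= p' -> q %= q' -> p * q %= p' * q'.
  by move=> pp qq; apply: eqp_trans (eqp_mulr _ pp) (eqp_mull _ qq).
rewrite (eqp_dvdl _ (eqM _ _ _ _ (prodE _) (hdE k k_n))).
rewrite (eqp_dvdr _ (eqM _ _ _ _ (prodE _) (hdE n (dvdnn n)))) -!big_split /=.
under eq_bigr => z _ do rewrite -exprD.
under [X in _ %| X]eq_bigr => z _ do rewrite -exprD.
apply: dvdp_prod_exp => z /countE[m m_n [mE ->]].
(* After cancelling the exponent of z in the denominator, the claim is
   [n == m] + [m %| k] <= 1: a point of exact period n is not fixed by f^k. *)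
rewrite -addnA leq_add2l !mE m_n; case: eqP => [<-|_]; last exact: leq_b1.
by rewrite gtnNdvd // (dvdn_gt0 n_gt0 k_n).
Qed.

(** * Integer polynomials without repeated roots *)

(** Over int, [%|] is pseudo-divisibility, that is divisibility up to a nonzero
    integer factor, hence divisibility over the rationals; this does not change
    under field extension. *)
Lemma dvdp_int_algC (p q : {poly int}) :
  (map_poly (intr : int -> algC) p %| map_poly intr q) = (p %| q).
Proof.
have fE (g : {poly int}) :
    map_poly (intr : int -> algC) g = map_poly ratr (map_poly (intr : int -> rat) g).
  by rewrite -map_poly_comp; apply: eq_map_poly => c; rewrite /= ratr_int.
by rewrite !fE dvdp_map dvdp_rat_int.
Qed.

(** The integer c is the factor that pseudo-division introduces.  It is chosen
    before the field, so one c serves all characteristics. *)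
Lemma dvdp_map_intr (p q : {poly int}) : p %| q ->
  exists2 c : int, c != 0 & forall K : fieldType,
    (c%:~R : K) != 0 -> map_poly (intr : int -> K) p %| map_poly intr q.
Proof.
case/Pdiv.Idomain.dvdpP=> [[c u] /= c0 E]; exists c => // K cK.
by rewrite -(dvdpZr _ _ cK) -map_polyZ E rmorphM /= dvdp_mull.
Qed.

Lemma no_repeated_roots_neq0 (h : {poly int}) : no_repeated_roots h -> h != 0.
Proof. by move=> sep; apply/eqP => h0; apply: (sep 0); rewrite h0 map_poly0 dvdp0. Qed.

(** A common factor of h and h' of positive degree would have a root z in the
    algebraic numbers, which would be a double root of h.  The integer N plays the
    role of a discriminant: h stays separable modulo the primes not dividing N. *)
Lemma no_repeated_roots_Bezout (h : {poly int}) : no_repeated_roots h ->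
  exists2 N : int, N != 0 & exists U V : {poly int}, U * h + V * h^`() = N%:P.
Proof.
move=> sep; suff : coprimep h h^`().
  case/Bezout_coprimepP => [[U V]] /=; rewrite -size_poly_eq1 => /size_poly1P[N N0 E].
  by exists N => //; exists U, V.
rewrite coprimep_def; set d := gcdp _ _.
have <- : size (map_poly (intr : int -> algC) d) = size d.
  by apply: size_map_inj_poly => //; apply: intr_inj.
apply/negPn/negP => /closed_rootP[z dz].
have rootz q : d %| q -> root (map_poly (intr : int -> algC) q) z.
  by rewrite -dvdp_int_algC => /dvdpP[u ->]; rewrite rootM dz orbT.
have hz := rootz _ (dvdp_gcdl _ _); have h'z := rootz _ (dvdp_gcdr _ _).
case/factor_theorem: hz => q hE; move: h'z; rewrite -deriv_map hE derivM derivXsubC mulr1.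
rewrite rootE hornerD hornerM hornerXsubC subrr mulr0 add0r -rootE.
case/factor_theorem => u qE; apply: (sep z).
by rewrite hE qE -mulrA -expr2 dvdp_mull.
Qed.

Lemma no_repeated_roots_split (h : {poly int}) : no_repeated_roots h ->
  exists2 r : seq algC, uniq r & map_poly intr h %= \prod_(z <- r) ('X - z%:P).
Proof.
move=> sep; have [r hE] := closed_field_poly_normal (map_poly (intr : int -> algC) h).
have hr : map_poly intr h %= \prod_(z <- r) ('X - z%:P).
  rewrite {1}hE eqp_scale // lead_coef_eq0 map_poly_eq0_id0 ?no_repeated_roots_neq0 //.
  by rewrite intr_eq0 lead_coef_eq0 no_repeated_roots_neq0.
exists r => //; rewrite -separable_prod_XsubC -(eqp_separable hr).
rewrite unlock; apply/Bezout_coprimepP; have [N N0 [U [V E]]] := no_repeated_roots_Bezout sep.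
exists (map_poly intr U, map_poly intr V) => /=.
by rewrite deriv_map -!rmorphM -rmorphD E /= map_polyC polyC_eqp1 intr_eq0.
Qed.

(** * The dynatomic polynomial over the integers *)

Lemma dynatomic_dvd_int (f : {poly int}) (n : nat) :
    (0 < n)%N -> no_repeated_roots (periodic_poly f n) ->
  dynatomic_den f n %| dynatomic_num f n
  /\ forall k, (k %| n)%N -> (k < n)%N ->
     dynatomic_num f n * periodic_poly f k
       %| dynatomic_den f n * periodic_poly f n.
Proof.
move=> n_gt0 /no_repeated_roots_split[r r_uniq]; rewrite map_periodic_poly => hr.
have [dvd1 dvd2] := dynatomic_dvd n_gt0 r_uniq hr.
split=> [|k k_n k_lt]; first by rewrite -dvdp_int_algC map_dynatomic_num map_dynatomic_den.
rewrite -dvdp_int_algC !rmorphM /= map_dynatomic_num map_dynatomic_den !map_periodic_poly.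
exact: dvd2.
Qed.

Lemma dynatomic_frac_eq (f : {poly int}) (n : nat) (fQ := map_poly (intr : int -> rat) f) :
    (forall d, d \in divisors n -> periodic_poly fQ d != 0) ->
  dynatomic_frac f n * FracField.tofrac (dynatomic_den fQ n)
    = FracField.tofrac (dynatomic_num fQ n).
Proof.
move=> h0; rewrite /dynatomic_frac !rmorph_prod /= [X in _ * X]big_mkcond [RHS]big_mkcond.
rewrite -big_split /= big_seq [RHS]big_seq; apply: eq_bigr => d /h0.
rewrite -tofrac_eq0 -/(periodic_poly _ _); set t := FracField.tofrac _ => t0.
rewrite (moebius_cases (n %/ d)).
case: eqP => [->|_]; first by rewrite /= subr0 mulr1.
by case: eqP => _; rewrite /= ?sub0r ?subr0 ?mulr1 // exprN1 mulVf.
Qed.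

Lemma periodic_poly_neq0 (R : idomainType) (f : {poly R}) (d n : nat) :
  (d %| n)%N -> periodic_poly f n != 0 -> periodic_poly f d != 0.
Proof.
move/(dvdp_periodic_poly f) => dv.
by apply: contraNneq => d0; rewrite d0 dvd0p in dv.
Qed.

Lemma dynatomic_den_neq0 (R : idomainType) (f : {poly R}) (n : nat) :
  (0 < n)%N -> periodic_poly f n != 0 -> dynatomic_den f n != 0.
Proof.
move=> n_gt0 hn0; rewrite prodf_seq_neq0; apply/allP => d.
rewrite -dvdn_divisors // => d_n; apply/implyP => _.
exact: periodic_poly_neq0 d_n hn0.
Qed.

Lemma dynatomic_int (f : {poly int}) (n : nat) :
    (0 < n)%N -> periodic_poly f n != 0 ->
    dynatomic_den f n %| dynatomic_num f n ->
  exists2 a : int, a != 0 & exists2 G : {poly int},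
    dynatomic f n = a%:~R^-1 *: map_poly intr G
    & a *: dynatomic_num f n = G * dynatomic_den f n.
Proof.
move=> n_gt0 hn0; pose fQ := map_poly (intr : int -> rat) f.
have inj : injective (map_poly (intr : int -> rat)).
  by apply: map_inj_poly => //; apply: intr_inj.
have hnQ : periodic_poly fQ n != 0.
  by rewrite -map_periodic_poly -(rmorph0 (map_poly (intr : int -> rat))) (inj_eq inj).
rewrite -dvdp_rat_int map_dynatomic_num map_dynatomic_den => /divpK.
set P := _ %/ _ => PE.
have dynE : dynatomic f n = P.
  rewrite -[RHS]poly_of_fracK; congr poly_of_frac.
  have den0 : FracField.tofrac (dynatomic_den fQ n) != 0.
    by rewrite tofrac_eq0 dynatomic_den_neq0.
  apply: (mulIf den0); rewrite dynatomic_frac_eq -?tofracM ?PE // => d.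
  by rewrite -dvdn_divisors // => d_n; apply: periodic_poly_neq0 d_n hnQ.
have [G [a a0 GE]] := rat_poly_scale P.
exists a => //; exists G; first by rewrite dynE.
apply: inj; rewrite map_polyZ rmorphM /= map_dynatomic_num map_dynatomic_den -PE GE.
by rewrite -scalerAl scalerA mulfV ?scale1r ?intr_eq0.
Qed.

(** * Reduction modulo p *)

(** Reduction of rationals is not a ring morphism because of the denominators
    divisible by p, so it is computed by hand on fractions c / a with a prime to p:
    their reduced denominator divides a. *)
Lemma root_reduce_rat (p : nat) (a : int) (G : {poly int}) (s : 'F_p) :
    a != 0 -> (a%:~R : 'F_p) != 0 ->
  root (reduce_rat p (a%:~R^-1 *: map_poly intr G)) s = root (map_poly intr G) s.
Proof.
move=> a0 ap.
have ratrE (c : int) : ratr (a%:~R^-1 * c%:~R : rat) = a%:~R^-1 * c%:~R :> 'F_p.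
  set x : rat := _ * _.
  have aQ : (a%:~R : rat) != 0 by rewrite intr_eq0.
  have dQ : ((denq x)%:~R : rat) != 0 by rewrite intr_eq0 denq_neq0.
  have xE : numq x * a = c * denq x.
    apply: (intr_inj (R := rat)); rewrite !intrM.
    have := divq_num_den x; rewrite {3}/x => E.
    by apply: (mulIf (invr_neq0 dQ)); rewrite mulrAC E mulfK // mulrAC mulVf ?mul1r.
  have d_a : (denq x %| a)%Z.
    rewrite -(Gauss_dvdzr _ (n := numq x)) ?xE ?dvdz_mull //.
    by rewrite coprimez_sym coprimezE coprime_num_den.
  have dp : ((denq x)%:~R : 'F_p) != 0.
    by apply: contra_neq ap; case/dvdzP: d_a => m -> d0; rewrite intrM d0 mulr0.
  rewrite /ratr; apply: (mulIf dp); apply: (mulIf ap).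
  rewrite mulfVK // mulrAC [_^-1 * _]mulrC -[_ / _ * _]mulrA mulVf // mulr1.
  by rewrite -!intrM xE.
have -> : reduce_rat p (a%:~R^-1 *: map_poly intr G) = a%:~R^-1 *: map_poly intr G.
  apply/polyP => i; rewrite coef_map_id0 ?coefZ ?coef_map ?ratrE //.
  by rewrite /ratr mul0r.
by rewrite rootZ // invr_eq0.
Qed.

(** Here g is the dynatomic polynomial up to the constant a.  The hypotheses are
    those that survive reduction modulo almost all primes. *)
Lemma root_dynatomic_period (K : fieldType) (f g : {poly K}) (n : nat) (a : K) (s : K) :
    (0 < n)%N -> a != 0 -> a *: dynatomic_num f n = g * dynatomic_den f n ->
    (forall k, (k %| n)%N -> (k < n)%N -> g * periodic_poly f k %| periodic_poly f n) ->
    separable_poly (periodic_poly f n) ->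
  root g s <-> has_period (horner f) n s.
Proof.
move=> n_gt0 a0 gE gdvd sep; split=> [gs | [_ /eqP per min]].
- have : root (dynatomic_num f n) s by rewrite -(rootZ _ _ a0) gE rootM gs.
  rewrite rootE horner_prod prodf_seq_eq0 => /hasP[d].
  rewrite -dvdn_divisors // => d_n /andP[_]; rewrite -rootE => hd.
  have : root (periodic_poly f n) s.
    by case/dvdpP: (dvdp_periodic_poly f d_n) => u ->; rewrite rootM hd orbT.
  rewrite root_periodic_poly => /eqP per.
  have [k kE] := exact_period n_gt0 per.
  have k_n : (k %| n)%N by rewrite -kE per.
  have k_eq : k = n.
    apply/eqP; move: (dvdn_leq n_gt0 k_n); rewrite leq_eqVlt => /orP[//|k_lt].
    have hk : root (periodic_poly f k) s by rewrite root_periodic_poly kE.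
    case/factor_theorem: gs => u gE'; case/factor_theorem: hk => v hkE.
    have sq : ('X - s%:P) ^+ 2 %| periodic_poly f n.
      apply: dvdp_trans (gdvd k k_n k_lt); rewrite gE' hkE.
      by rewrite mulrACA -expr2 dvdp_mull.
    have := separable_nosquare sep (k := 2) (u := 'X - s%:P).
    by rewrite size_XsubC sq => /(_ isT isT).
  split=> // m /andP[m_gt0 m_lt] /eqP; rewrite kE k_eq => /(dvdn_leq m_gt0).
  by rewrite leqNgt m_lt.
- have den_s : ~~ root (dynatomic_den f n) s.
    rewrite rootE horner_prod prodf_seq_neq0; apply/allP => d.
    rewrite -dvdn_divisors // => d_n; apply/implyP => mu.
    rewrite -rootE root_periodic_poly; apply/eqP; apply: min.
    rewrite (dvdn_gt0 n_gt0 d_n) ltn_neqAle dvdn_leq // andbT.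
    by apply: contraTneq mu => ->; rewrite divnn n_gt0.
  have : root (g * dynatomic_den f n) s.
    rewrite -gE rootZ // rootE horner_prod prodf_seq_eq0; apply/hasP; exists n.
      exact: divisors_id.
    by rewrite divnn n_gt0 -rootE root_periodic_poly per.
  by rewrite rootM (negPf den_s) orbF.
Qed.

Theorem corollary4p3 (f : {poly int}) (n : nat) (n_gt0 : (0 < n)%N)
    (sep : no_repeated_roots (iter_poly f n - 'X)) :
  exists exceptions : seq nat, forall p : nat, prime p -> p \notin exceptions ->
    ((exists a : 'F_p, root (reduce_rat p (dynatomic f n)) a) <->
     (exists s : 'F_p,
        has_period (fun x : 'F_p => (reduce_int p f).[x]) n s)).
Proof.
have [dvd1 dvd2] := dynatomic_dvd_int n_gt0 sep.
have hn0 := no_repeated_roots_neq0 sep.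
have [a a0 [G dynE GE]] := dynatomic_int n_gt0 hn0 dvd1.
have [N N0 [U [V UVE]]] := no_repeated_roots_Bezout sep.
have den0 := dynatomic_den_neq0 n_gt0 hn0.
have /fin_all_exists[c cP] (k : 'I_n) : exists c : int, c != 0 /\
    forall K : fieldType, (c%:~R : K) != 0 -> (k %| n)%N ->
    map_poly (intr : int -> K) (G * periodic_poly f k) %| map_poly intr (periodic_poly f n).
  (* If k does not divide n there is nothing to require, and 1 does not affect the
     product e below. *)
  case: (boolP (k %| n)%N) => [k_n|_]; last by exists 1.
  have : G * periodic_poly f k %| periodic_poly f n.
    rewrite -(dvdp_mul2l _ _ den0) mulrA [_ * G]mulrC -GE -scalerAl dvdpZl //.
    exact: dvd2.
  by case/dvdp_map_intr => c c0 cK; exists c; split=> // K ck _; apply: cK.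
(* Outside the primes dividing e, every identity above can be reduced mod p. *)
set e : int := a * N * \prod_k c k.
have e0 : e != 0 by rewrite !mulf_neq0 //; apply/prodf_neq0 => k _; case: (cP k).
exists (primes `|e|) => p p_pr; rewrite mem_primes p_pr absz_gt0 e0 /= => ndvd.
have : (e%:~R : 'F_p) != 0 by rewrite -(dvdz_pcharf (pchar_Fp p_pr)).
rewrite !rmorphM rmorph_prod /= !mulf_eq0 !negb_or => /andP[/andP[ap Np] /prodf_neq0 cp].
pose fp := map_poly (intr : int -> 'F_p) f.
have perP s : root (map_poly intr G) s <-> has_period (horner fp) n s.
  apply: (root_dynatomic_period (a := a%:~R)) => //.
  - by rewrite -map_dynatomic_num -map_dynatomic_den -map_polyZ GE rmorphM.
  - move=> k k_n k_lt; rewrite -!map_periodic_poly -rmorphM.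
    exact: (proj2 (cP (Ordinal k_lt))) (cp (Ordinal k_lt) isT) k_n.
  - rewrite -map_periodic_poly unlock deriv_map.
    apply/Bezout_coprimepP; exists (map_poly intr U, map_poly intr V) => /=.
    by rewrite -!rmorphM -rmorphD UVE /= map_polyC polyC_eqp1.
rewrite dynE; split=> -[s].
- by rewrite root_reduce_rat // => /perP sP; exists s.
- by move=> /perP sP; exists s; rewrite root_reduce_rat.
Qed.
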